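(* Let $R=K[a_1,\dots,a_n]$ be a $K$-algebra generated by $a_1,\dots,a_n$ with a two-sided admissible system $(\mathcal{B},\prec)$, where $\mathcal{B}$ is a skew multiplicative $K$-basis of $R$ and $\prec$ is a two-sided monomial ordering on $\mathcal{B}$. Suppose that, for some permutation $a_{\ell_1},\dots,a_{\ell_n}$ of $a_1,\dots,a_n$, the basis $\mathcal{B}$ contains every monomial $a_{\ell_1}^{\alpha_1}a_{\ell_2}^{\alpha_2}\cdots a_{\ell_n}^{\alpha_n}$ with $\alpha_1,\dots,\alpha_n\in\mathbb{N}$. Suppose that $\mathcal{G}=\Omega\cup G$ is a minimal Gröbner basis of the ideal $I=\langle\mathcal{G}\rangle$, where $\Omega\subset\mathcal{B}$ and $G$ consists of $\frac{n(n-1)}{2}$ elements $$g_{ji}=a_{\ell_j}a_{\ell_i}-\lambda_{ji}a_{\ell_i}a_{\ell_j},\quad 1\le i<j\le n,\ \lambda_{ji}\in K^*\cup\{0\},$$ such that $\mathbf{LM}(g_{ji})=a_{\ell_j}a_{\ell_i}$ for $1\le i<j\le n$. Let $A=R/I$. Then: (i) $N(I)\subseteq\{a_{\ell_1}^{\alpha_1}a_{\ell_2}^{\alpha_2}\cdots a_{\ell_n}^{\alpha_n}\mid\alpha_1,\dots,\alpha_n\in\mathbb{N}\}$, and $\overline{N(I)}$ is a skew multiplicative $K$-basis of $A$. (ii) If $\overline{a_{\ell_1}}^{\alpha_1}\overline{a_{\ell_2}}^{\alpha_2}\cdots\overline{a_{\ell_n}}^{\alpha_n}\ne 0$ implies $a_{\ell_1}^{\alpha_1}a_{\ell_2}^{\alpha_2}\cdots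 a_{\ell_n}^{\alpha_n}\in N(I)$, then $A$ has a two-sided Gröbner basis theory with respect to the two-sided admissible system $(\overline{N(I)},\prec_I)$, where $\prec_I$ is the two-sided monomial ordering on $\overline{N(I)}$ induced by any one of the following orderings on $\mathbb{N}^n$: the lexicographic ordering, the $\mathbb{N}$-graded lexicographic ordering, and the $\mathbb{N}$-graded reverse lexicographic ordering, such that $\overline{a_{\ell_n}}\prec_I\overline{a_{\ell_{n-1}}}\prec_I\cdots\prec_I\overline{a_{\ell_2}}\prec_I\overline{a_{\ell_1}}$.
   Context: $K$ is a field, $K^*=K\setminus\{0\}$, $\mathbb{N}$ is the set of nonnegative integers; a $K$-algebra is a finitely generated associative $K$-algebra with identity $1$; an ideal is a two-sided ideal; $\langle S\rangle$ is the two-sided ideal generated by $S$. A skew multiplicative $K$-basis of a $K$-algebra $\Lambda$ generated by $a_1,\dots,a_n$ is a $K$-basis $\mathcal{B}$ consisting of products of powers of the generators such that for all $u,v\in\mathcal{B}$ either $uv=0$ or $uv=\lambda w$ with $\lambda\in K^*$, $w\in\mathcal{B}$. Elements of $\mathcal{B}$ are called monomials. Given a well-ordering $\prec$ on $\mathcal{B}$ and $0\ne f=\sum_{i=1}^s\lambda_iu_i$ with $\lambda_i\in K^*$, $u_i\in\mathcal{B}$, $u_1\prec\cdots\prec u_s$, put $\mathbf{LM}(f)=u_s$; also $\mathbf{LM}(0)=0$. A well-ordering $\prec$ on $\mathcal{B}$ is a two-sided monomial ordering if: (MO1) whenever $w,u,v,s\in\mathcal{B}$, $w\prec u$ and $\mathbf{LM}(vws),\mathbf{LM}(vus)\notin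 K^*\cup\{0\}$, then $\mathbf{LM}(vws)\prec\mathbf{LM}(vus)$; (MO2) for $w,u\in\mathcal{B}$, if $u=\mathbf{LM}(vws)$ for some $v,s\in\mathcal{B}$ with $v\ne1$ or $s\ne1$ (in case $1\in\mathcal{B}$), then $w\prec u$. The pair $(\mathcal{B},\prec)$ is then a two-sided admissible system, and an algebra with a skew multiplicative $K$-basis having a two-sided admissible system is said to have a two-sided Gröbner basis theory. For $u,v\in\mathcal{B}$, $u\mid v$ means $v=\lambda wus$ for some $w,s\in\mathcal{B}$, $\lambda\in K^*$. For an ideal $I$ of $R$, a subset $\mathcal{G}\subset I$ of nonzero elements is a Gröbner basis of $I$ if for each nonzero $f\in I$ there is $g\in\mathcal{G}$ with $\mathbf{LM}(g)\mid\mathbf{LM}(f)$; it is minimal if no proper subset is a Gröbner basis of $I$. $N(I)=\{u\in\mathcal{B}\mid\mathbf{LM}(f)\nmid u\text{ for all }0\ne f\in I\}$ is the set of normal monomials. For $f\in R$, $\bar f=f+I$; $\overline{N(I)}=\{\bar u\mid u\in N(I)\}$. The ordering $\prec_I$ induced by an ordering $<$ on $\mathbb{N}^n$: $\overline{a_{\ell_1}}^{\alpha_1}\cdots\overline{a_{\ell_n}}^{\alpha_n}\prec_I\overline{a_{\ell_1}}^{\beta_1}\cdots\overline{a_{\ell_n}}^{\beta_n}$ iff $\alpha<\beta$. With $|\alpha|=\alpha_1+\cdots+\alpha_n$: lexicographic (from the left): $\alpha<\beta$ iff $\alpha_i<\beta_i$ at the first index $i$ where they differ; $\mathbb{N}$-graded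 lexicographic: $|\alpha|<|\beta|$, or $|\alpha|=|\beta|$ and $\alpha$ is lexicographically smaller than $\beta$; $\mathbb{N}$-graded reverse lexicographic: $|\alpha|<|\beta|$, or $|\alpha|=|\beta|$ and $\alpha_i>\beta_i$ at the last index $i$ where they differ.
   Formalization: Part (ii) additionally assumes that ordered monomials with different exponents are different elements of R; otherwise the induced ordering may be ill-defined, as for R=K[x], a_1=x, a_2=x^2, G={x^3}. *)

(* Defs.v *)
From HB Require Import structures.
From mathcomp Require Import all_boot all_order all_algebra all_fingroup.
From mathcomp Require Import generic_quotient ring_quotient.
From mathcomp Require Import boolp classical_sets functions cardinality.

Set Implicit Arguments.
Unset Strict Implicit.
Unset Printing Implicit Defensive.

Import GRing.Theory.
Local Open Scope classical_set_scope.
Local Open Scope ring_scope.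
Local Open Scope quotient_scope.

(* Unital associative K-algebras that may be zero, which happens for R / I when
   I = R; GRing.Algebra excludes the zero ring, and the library has no common
   structure for modules and possibly zero rings. *)
HB.mixin Record PzRing_hasScale (K : pzRingType) A of GRing.PzRing A := {
  scal : K -> A -> A;
  scalA : forall c d x, scal c (scal d x) = scal (c * d) x;
  scal1 : forall x, scal 1 x = x;
  scalDr : forall c x y, scal c (x + y) = scal c x + scal c y;
  scalDl : forall c d x, scal (c + d) x = scal c x + scal d x;
  scalAl : forall c x y, scal c (x * y) = scal c x * y;
  scalAr : forall c x y, scal c (x * y) = x * scal c y
}.

#[short(type="pzAlgType")]
HB.structure Definition PzAlgebra (K : pzRingType) :=
  {A of GRing.PzRing A & PzRing_hasScale K A}.

#[non_forgetful_inheritance]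
HB.instance Definition _ (K : pzRingType) (R : algType K) :=
  PzRing_hasScale.Build K R (@scalerA K R) (@scale1r K R) (@scalerDr K R)
    (fun c d x => @scalerDl K R x c d) (@scalerAl K R) (@scalerAr K R).

Lemma scalE (K : pzRingType) (R : algType K) (c : K) (x : R) : scal c x = c *: x.
Proof. by []. Qed.

Section QuotientAlgebra.
Variables (K : fieldType) (R : algType K).

Definition two_sided_ideal (I : set R) : Prop :=
  [/\ I 0,
      forall x y, I x -> I y -> I (x + y),
      forall r x, I x -> I (r * x)
    & forall r x, I x -> I (x * r)].

Record ideal := Ideal {
  ideal_set :> set R;
  idealP : two_sided_ideal ideal_set }.

Lemma smallest_two_sided_ideal (S : set R) :
  two_sided_ideal (smallest two_sided_ideal S).
Proof.
split=> [J [[]]//|x y Ix Iy J JP|r x Ix J JP|r x Ix J JP];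
  case: (JP) => -[? JD Jl Jr] ?; [apply: JD | apply: Jl | apply: Jr];
  by [apply: Ix | apply: Iy].
Qed.

Definition generated_ideal (S : set R) : ideal :=
  Ideal (smallest_two_sided_ideal S).

Variable I : ideal.

Definition ideal_pred : {pred R} := fun x => `[< (I : set R) x >].

Fact ideal_pred_zmod_closed : zmod_closed ideal_pred.
Proof.
case: (idealP I) => I0 ID Il _; split; first exact/asboolP.
move=> x y /asboolP Ix /asboolP Iy; apply/asboolP.
by apply: ID => //; rewrite -mulN1r; apply: Il.
Qed.
HB.instance Definition _ :=
  GRing.isZmodClosed.Build R ideal_pred ideal_pred_zmod_closed.

Definition quot_alg : Type := Quotient.quot ideal_pred.
HB.instance Definition _ := GRing.Zmodule.on quot_alg.
HB.instance Definition _ := Quotient.on quot_alg.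

Definition quot_class (x : R) : quot_alg := \pi_(Quotient.quot ideal_pred) x.

Lemma quot_classP (x y : R) : quot_class x = quot_class y <-> (I : set R) (x - y).
Proof.
rewrite /quot_class; split.
  by move=> /eqP; rewrite -Quotient.idealrBE => /asboolP.
by move=> Ixy; apply/eqP; rewrite -Quotient.idealrBE; apply/asboolP.
Qed.

Lemma quot_classK (x : quot_alg) : quot_class (repr x) = x.
Proof. exact: reprK. Qed.

Lemma quot_classD x y : quot_class (x + y) = quot_class x + quot_class y.
Proof. exact: raddfD. Qed.

Definition quot_one : quot_alg := quot_class 1.
Definition quot_mul (x y : quot_alg) : quot_alg :=
  quot_class (repr x * repr y).
Definition quot_scale (c : K) (x : quot_alg) : quot_alg :=
  quot_class (c *: repr x).

Lemma ideal_reprB x : (I : set R) (repr (quot_class x) - x).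
Proof. by apply/quot_classP; rewrite quot_classK. Qed.

Lemma quot_mulE x y : quot_mul (quot_class x) (quot_class y) = quot_class (x * y).
Proof.
case: (idealP I) => _ ID Il Ir; apply/quot_classP.
set x' := repr _; set y' := repr _.
have -> : x' * y' - x * y = (x' - x) * y' + x * (y' - y).
  by rewrite mulrBl mulrBr addrA subrK.
by apply: ID; [apply: Ir | apply: Il]; apply: ideal_reprB.
Qed.

Lemma quot_scaleE c x : quot_scale c (quot_class x) = quot_class (c *: x).
Proof.
case: (idealP I) => _ _ Il _; apply/quot_classP.
by rewrite -scalerBr -[_ - _]mul1r scalerAl; apply/Il/ideal_reprB.
Qed.

Lemma quot_ind (P : quot_alg -> Prop) : (forall x, P (quot_class x)) -> forall q, P q.
Proof. by move=> Pc q; rewrite -(quot_classK q). Qed.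

Fact quot_mulA : associative quot_mul.
Proof.
by do 3![elim/quot_ind=> ?]; rewrite !quot_mulE mulrA.
Qed.
Fact quot_mul1q : left_id quot_one quot_mul.
Proof. by elim/quot_ind=> x; rewrite quot_mulE mul1r. Qed.
Fact quot_mulq1 : right_id quot_one quot_mul.
Proof. by elim/quot_ind=> x; rewrite quot_mulE mulr1. Qed.
Fact quot_mulDl : left_distributive quot_mul +%R.
Proof.
by do 3![elim/quot_ind=> ?]; rewrite -quot_classD !quot_mulE mulrDl quot_classD.
Qed.
Fact quot_mulDr : right_distributive quot_mul +%R.
Proof.
by do 3![elim/quot_ind=> ?]; rewrite -quot_classD !quot_mulE mulrDr quot_classD.
Qed.
HB.instance Definition _ := GRing.Zmodule_isPzRing.Build quot_alg
  quot_mulA quot_mul1q quot_mulq1 quot_mulDl quot_mulDr.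

Fact quot_scaleA c d x : quot_scale c (quot_scale d x) = quot_scale (c * d) x.
Proof. by elim/quot_ind: x => x; rewrite !quot_scaleE scalerA. Qed.
Fact quot_scale1 : left_id 1 quot_scale.
Proof. by elim/quot_ind=> x; rewrite quot_scaleE scale1r. Qed.
Fact quot_scaleDr c x y :
  quot_scale c (x + y) = quot_scale c x + quot_scale c y.
Proof.
move: x y; do 2![elim/quot_ind=> ?].
by rewrite -quot_classD !quot_scaleE scalerDr quot_classD.
Qed.
Fact quot_scaleDl c d x :
  quot_scale (c + d) x = quot_scale c x + quot_scale d x.
Proof.
by elim/quot_ind: x => x; rewrite !quot_scaleE scalerDl quot_classD.
Qed.
Fact quot_scaleAl c x y : quot_scale c (quot_mul x y) = quot_mul (quot_scale c x) y.
Proof.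
elim/quot_ind: x => x; elim/quot_ind: y => y.
by rewrite quot_mulE !quot_scaleE quot_mulE scalerAl.
Qed.
Fact quot_scaleAr c x y : quot_scale c (quot_mul x y) = quot_mul x (quot_scale c y).
Proof.
elim/quot_ind: x => x; elim/quot_ind: y => y.
by rewrite quot_mulE !quot_scaleE quot_mulE scalerAr.
Qed.
HB.instance Definition _ := PzRing_hasScale.Build K quot_alg
  quot_scaleA quot_scale1 quot_scaleDr quot_scaleDl quot_scaleAl quot_scaleAr.

End QuotientAlgebra.

Section AdmissibleSystem.
Variables (K : fieldType) (A : pzAlgType K).

Definition is_basis (B : set A) : Prop :=
  (forall (s : seq A) (c : A -> K), uniq s -> (forall u, u \in s -> B u) ->
     \sum_(u <- s) scal (c u) u = 0 -> forall u, u \in s -> c u = 0) /\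
  (forall f : A, exists (s : seq A) (c : A -> K),
     (forall u, u \in s -> B u) /\ f = \sum_(u <- s) scal (c u) u).

Definition well_ordering (B : set A) (prec : A -> A -> Prop) : Prop :=
  [/\ forall u, B u -> ~ prec u u,
      forall u v w, B u -> B v -> B w -> prec u v -> prec v w -> prec u w,
      forall u v, B u -> B v -> [\/ prec u v, u = v | prec v u]
    & forall C : set A, C `<=` B -> C !=set0 ->
        exists2 m, C m & forall u, C u -> u <> m -> prec m u].

Definition is_leading (B : set A) (prec : A -> A -> Prop) (f u : A) : Prop :=
  exists (s : seq A) (c : A -> K),
    [/\ uniq s,
        forall v, v \in s -> B v /\ c v != 0,
        f = \sum_(v <- s) scal (c v) v,
        u \in s
      & forall v, v \in s -> v <> u -> prec v u].

(* Nothing is leading for 0, so LM B prec 0 = 0 as soon as B is a basis. *)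
Definition LM (B : set A) (prec : A -> A -> Prop) (f : A) : A :=
  xget 0 [set u | is_leading B prec f u].

Definition subalgebra (S : set A) : Prop :=
  [/\ S 1,
      forall x y, S x -> S y -> S (x + y),
      forall x y, S x -> S y -> S (x * y)
    & forall (c : K) x, S x -> S (scal c x)].

Definition generated_by (n : nat) (a : 'I_n -> A) : Prop :=
  smallest subalgebra (range a) = setT.

Definition skew_multiplicative_basis (n : nat) (a : 'I_n -> A) (B : set A) :=
  [/\ is_basis B,
      forall u, B u -> exists s : seq ('I_n * nat),
        u = \prod_(p <- s) a p.1 ^+ p.2
    & forall u v, B u -> B v ->
        u * v = 0 \/
        exists (c : K) (w : A), [/\ c != 0, B w & u * v = scal c w]].

Definition is_scalar (x : A) : Prop := exists c : K, x = scal c 1.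

(* In the last clause the condition v <> 1 \/ s <> 1 holds automatically when
   1 is not in B. *)
Definition two_sided_monomial_ordering (B : set A) (prec : A -> A -> Prop) :=
  [/\ well_ordering B prec,
      forall w u v s, B w -> B u -> B v -> B s -> prec w u ->
        ~ is_scalar (LM B prec (v * w * s)) -> ~ is_scalar (LM B prec (v * u * s)) ->
        prec (LM B prec (v * w * s)) (LM B prec (v * u * s))
    & forall w u v s, B w -> B u -> B v -> B s -> (v <> 1 \/ s <> 1) ->
        u = LM B prec (v * w * s) -> prec w u].

Definition two_sided_admissible_system (n : nat) (a : 'I_n -> A)
    (B : set A) (prec : A -> A -> Prop) : Prop :=
  skew_multiplicative_basis a B /\ two_sided_monomial_ordering B prec.

Definition monomial_divides (B : set A) (u v : A) : Prop :=
  exists (c : K) (w s : A), [/\ c != 0, B w, B s & v = scal c (w * u * s)].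

Definition groebner_basis (B : set A) (prec : A -> A -> Prop)
    (I GB : set A) : Prop :=
  [/\ GB `<=` I,
      forall g, GB g -> g <> 0
    & forall f, I f -> f <> 0 ->
        exists2 g, GB g & monomial_divides B (LM B prec g) (LM B prec f)].

Definition minimal_groebner_basis (B : set A) (prec : A -> A -> Prop)
    (I GB : set A) : Prop :=
  groebner_basis B prec I GB /\
  forall H, H `<` GB -> ~ groebner_basis B prec I H.

Definition normal_monomials (B : set A) (prec : A -> A -> Prop)
    (I : set A) : set A :=
  [set u | B u /\
     forall f, I f -> f <> 0 -> ~ monomial_divides B (LM B prec f) u].

(* The product is taken in increasing order of i; the permutation l lists the
   generators as a (l 0), a (l 1), ..., a (l (n - 1)). *)
Definition ordered_monomial (n : nat) (a : 'I_n -> A) (l : 'S_n)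
    (alpha : {ffun 'I_n -> nat}) : A :=
  \prod_(i < n) a (l i) ^+ alpha i.

(* The ordering on N compares the exponents of ordered monomials, hence is well
   defined only when an element of N is an ordered monomial in one way. *)
Definition induced_ordering (n : nat) (a : 'I_n -> A) (l : 'S_n) (N : set A)
    (lt : {ffun 'I_n -> nat} -> {ffun 'I_n -> nat} -> Prop) (x y : A) : Prop :=
  [/\ N x, N y & exists alpha beta,
    [/\ x = ordered_monomial a l alpha, y = ordered_monomial a l beta
      & lt alpha beta]].

End AdmissibleSystem.

Section ExponentOrderings.
Variable n : nat.
Implicit Types alpha beta : {ffun 'I_n -> nat}.

Definition degree alpha : nat := (\sum_(i < n) alpha i)%N.

Definition lex_lt alpha beta : Prop :=
  exists i : 'I_n,
    (forall k : 'I_n, (k < i)%N -> alpha k = beta k) /\ (alpha i < beta i)%N.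

Definition grlex_lt alpha beta : Prop :=
  (degree alpha < degree beta)%N \/
  degree alpha = degree beta /\ lex_lt alpha beta.

Definition grevlex_lt alpha beta : Prop :=
  (degree alpha < degree beta)%N \/
  degree alpha = degree beta /\
  exists i : 'I_n,
    (forall k : 'I_n, (i < k)%N -> alpha k = beta k) /\ (beta i < alpha i)%N.

End ExponentOrderings.

(* Main.v *)
(* Modulo I every monomial outside N(I) either vanishes or, by a relation g_ji,
   equals up to a unit a smaller monomial; hence it vanishes or is a scalar
   multiple of a normal monomial, and normal monomials contain no factor
   a_{l_j} a_{l_i} with i < j, so they are ordered.  In A ordered monomials
   multiply by adding exponents, up to a scalar, so that an ordering of the
   exponents which is compatible with addition induces a monomial ordering.
   All three orderings compare lexicographically a list of additive weights,
   which gives the well-ordering property and compatibility at once. *)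
Require Import Defs.
From HB Require Import structures.
From mathcomp Require Import all_boot all_order all_algebra all_fingroup.
From mathcomp Require Import boolp classical_sets functions cardinality.
From mathcomp Require Import zify.

Set Implicit Arguments.
Unset Strict Implicit.
Unset Printing Implicit Defensive.

Import GRing.Theory.
Local Open Scope classical_set_scope.
Local Open Scope ring_scope.

(** * Exponent orderings *)

Section WeightOrderings.
Variable n : nat.
Implicit Types alpha beta gamma : {ffun 'I_n -> nat}.

(** Three difficulties shape the proof. The ordering axiom for products is silent when a leading
    monomial is a scalar; full compatibility is recovered because 1, the ordered monomial with zero
    exponents, lies in [B] and is its least element. The condition on the leading monomial of g_ji
    does not say outright that a_{l_j} a_{l_i} belongs to [B] or that the other term is smaller; the
    two terms may even be proportional, and then the product lies in I. Comparing two generators in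
    A requires their normality, which is where minimality of the Groebner basis enters. In part (ii)
    the exponents of a nonzero class are unique for two reasons: normal monomials with equal classes
    coincide, and distinct exponents give distinct ordered monomials. *)

Definition weight (p : pred 'I_n) alpha : nat := (\sum_(i < n | p i) alpha i)%N.

Definition weight_lt (m : nat) (p : nat -> pred 'I_n) alpha beta : Prop :=
  exists k, [/\ (k < m)%N, (forall j, (j < k)%N -> weight (p j) alpha = weight (p j) beta)
              & (weight (p k) alpha < weight (p k) beta)%N].

(** Without this, distinct exponents with equal weights would be incomparable, and neither totality
    nor the existence of a least element would follow. *)
Definition weight_separating m (p : nat -> pred 'I_n) :=
  forall alpha beta,
    (forall k, (k < m)%N -> weight (p k) alpha = weight (p k) beta) -> alpha = beta.

Definition exp_add alpha beta : {ffun 'I_n -> nat} := [ffun i => (alpha i + beta i)%N].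

Lemma weightD p alpha beta :
  weight p (exp_add alpha beta) = (weight p alpha + weight p beta)%N.
Proof. by rewrite /weight -big_split; apply: eq_bigr => i _; rewrite ffunE. Qed.

Lemma weight_eq1 i alpha : weight (pred1 i) alpha = alpha i.
Proof. by rewrite /weight big_pred1_eq. Qed.

Lemma eq_weight p q alpha : p =1 q -> weight p alpha = weight q alpha.
Proof. by move=> pq; apply: eq_bigl. Qed.

Section Weights.
Variables (m : nat) (p : nat -> pred 'I_n).
Local Notation lt := (weight_lt m p).

Lemma weight_lt_irr alpha : ~ lt alpha alpha.
Proof. by case=> k [_ _]; rewrite ltnn. Qed.

Lemma weight_lt_trans beta alpha gamma : lt alpha beta -> lt beta gamma -> lt alpha gamma.
Proof.
case=> k [km kE klt] [k' [km' kE' klt']].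
case: (ltngtP k k') => kk.
- exists k; split=> // [j jk|]; first by rewrite kE // kE' //; lia.
  by rewrite -(kE' _ kk).
- exists k'; split=> // [j jk|]; first by rewrite kE ?kE' //; lia.
  by rewrite (kE _ kk).
- subst k'; exists k; split=> // [j jk|]; first by rewrite kE ?kE'.
  exact: ltn_trans klt klt'.
Qed.

Lemma weight_lt_add gamma delta alpha beta : lt alpha beta ->
  lt (exp_add (exp_add gamma alpha) delta) (exp_add (exp_add gamma beta) delta).
Proof.
case=> k [km kE klt]; exists k; split=> // [j jk|]; rewrite !weightD.
  by rewrite kE.
by rewrite ltn_add2r ltn_add2l.
Qed.

Hypothesis sep : weight_separating m p.

Lemma weight_lt_total alpha beta : [\/ lt alpha beta, alpha = beta | lt beta alpha].
Proof.
case: (pselect (exists k, (k < m)%N /\ weight (p k) alpha <> weight (p k) beta)).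
  move=> ex.
  have ex' : exists k, (k < m)%N && (weight (p k) alpha != weight (p k) beta).
    by case: ex => k [km /eqP kn]; exists k; rewrite km.
  case: (ex_minnP ex') => k /andP[km kn] kmin.
  have kE j : (j < k)%N -> weight (p j) alpha = weight (p j) beta.
    move=> jk; apply/eqP; apply: contraTT jk => jn; rewrite -leqNgt.
    by case: (ltnP j m) => mj; [apply: kmin; rewrite mj jn | lia].
  move: kn; case: (ltngtP (weight (p k) alpha) (weight (p k) beta)) => // kl _.
    by constructor 1; exists k.
  by constructor 3; exists k; split=> // j /kE.
move=> nex; constructor 2; apply: sep => k km.
by apply: contrapT => kn; apply: nex; exists k.
Qed.

(** Adding exponents never lowers a weight, so by totality only equality has to be excluded, which
    is done coordinatewise. *)
Lemma weight_lt_addl gamma delta alpha :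
  gamma <> [ffun=> 0%N] \/ delta <> [ffun=> 0%N] ->
  lt alpha (exp_add (exp_add gamma alpha) delta).
Proof.
move=> nz; case: (weight_lt_total alpha (exp_add (exp_add gamma alpha) delta)) => //.
  move/ffunP => E; exfalso; case: nz; apply; apply/ffunP => i;
  move: (E i); rewrite !ffunE; move: (gamma i) (alpha i) (delta i) => x y z; lia.
by case=> k [_ _]; rewrite !weightD => klt; exfalso; lia.
Qed.

(** The weights are minimized one after another: after [m'] rounds each element of [C] is either
    already larger than [mu] or ties with it on the first [m'] weights, and the next round minimizes
    the next weight among the ties. Separation removes the ties left after [m] rounds. *)
Lemma weight_lt_min (C : set {ffun 'I_n -> nat}) : C !=set0 ->
  exists2 mu, C mu & forall alpha, C alpha -> alpha <> mu -> lt mu alpha.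
Proof.
move=> C0.
have [mu Cmu muP] : exists2 mu, C mu & forall alpha, C alpha ->
    lt mu alpha \/ forall k, (k < m)%N -> weight (p k) mu = weight (p k) alpha.
  have : (m <= m)%N by [].
  rewrite /weight_lt; move: {1 3 4}m; elim=> [_|m' IH mm].
    by case: C0 => mu Cmu; exists mu => // alpha _; right.
  case: (IH (ltnW mm)) => mu0 Cmu0 mu0P.
  pose D := [set alpha | C alpha /\
    forall k, (k < m')%N -> weight (p k) mu0 = weight (p k) alpha].
  have ex : exists w, `[< exists2 alpha, D alpha & weight (p m') alpha = w >].
    by exists (weight (p m') mu0); apply/asboolP; exists mu0.
  case: (ex_minnP ex) => w /asboolP[mu [Cmu muE] muw] wmin.
  exists mu => // alpha Calpha.
  case: (mu0P _ Calpha) => [[k [km kE klt]]|E].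
    left; exists k; split=> //; first exact: ltnW.
    - by move=> j jk; rewrite -muE ?kE //; lia.
    - by rewrite -muE.
  have : (w <= weight (p m') alpha)%N.
    by apply: wmin; apply/asboolP; exists alpha.
  rewrite leq_eqVlt -muw => /predU1P[wE|wlt].
    right=> k; rewrite ltnS leq_eqVlt => /predU1P[->//|km].
    by rewrite -muE // E.
  left; exists m'; split=> // j jm; by rewrite -muE ?E.
exists mu => // alpha Calpha na; case: (muP _ Calpha) => // E.
by case: na; apply/esym/sep.
Qed.

End Weights.

Definition exp_one (i : 'I_n) : {ffun 'I_n -> nat} := [ffun k => (k == i : nat)].

Lemma lex_ltE : weight_lt n (fun k i => val i == k) = @lex_lt n.
Proof.
apply/funext => alpha; apply/funext => beta; apply/propext; split.
  case=> k [km kE]; rewrite !(@eq_weight _ (pred1 (Ordinal km))) // !weight_eq1 => klt.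
  exists (Ordinal km); split=> // j jk; move: (kE j jk).
  by rewrite !(@eq_weight _ (pred1 j)) // !weight_eq1.
case=> i [iE ilt]; exists i; split=> //.
  move=> j ji; have jn := ltn_trans ji (ltn_ord i).
  by rewrite !(@eq_weight _ (pred1 (Ordinal jn))) // !weight_eq1 iE.
by rewrite !(@eq_weight _ (pred1 i)) // !weight_eq1.
Qed.

Lemma lex_separating : weight_separating n (fun k (i : 'I_n) => val i == k).
Proof.
move=> alpha beta E; apply/ffunP => i; move: (E i (ltn_ord i)).
by rewrite !(@eq_weight _ (pred1 i)) // !weight_eq1.
Qed.

Definition grlex_weight (k : nat) : pred 'I_n :=
  fun i => if k is k'.+1 then val i == k' else true.

Lemma grlex_ltE : weight_lt n.+1 grlex_weight = @grlex_lt n.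
Proof.
apply/funext => alpha; apply/funext => beta; apply/propext.
rewrite /grlex_lt -lex_ltE; split.
  case=> -[|k] [km kE klt]; first by left.
  right; split; first exact: kE 0%N _.
  by exists k; split=> // j jk; apply: kE j.+1 _.
case=> [dlt|[dE [k [km kE klt]]]]; first by exists 0%N.
by exists k.+1; split=> // -[//|j] jk; apply: kE.
Qed.

Lemma grlex_separating : weight_separating n.+1 grlex_weight.
Proof. by move=> alpha beta E; apply: lex_separating => k kn; apply: (E k.+1). Qed.

(* In equal degree, comparing the last exponents in reverse amounts to comparing
   the sums of the exponents before them, which are additive. *)
Definition grevlex_weight (k : nat) : pred 'I_n := fun i => (i + k < n)%N.

(** Passing from [k] to [k.+1] drops exactly one exponent, at position n - k - 1. The index
    conversions below all come from this. *)
Lemma grevlex_weightS alpha (i : 'I_n) k : (i + k.+1 = n)%N ->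
  weight (grevlex_weight k) alpha = (weight (grevlex_weight k.+1) alpha + alpha i)%N.
Proof.
move=> ik; rewrite /weight (bigD1 i) /=; last by rewrite /grevlex_weight; lia.
rewrite addnC; congr (_ + _)%N; apply: eq_bigl => j; rewrite /grevlex_weight.
by rewrite -val_eqE /=; lia.
Qed.

Lemma grevlex_weight0 alpha : weight (grevlex_weight 0) alpha = degree alpha.
Proof. by apply: eq_bigl => i; rewrite /grevlex_weight addn0 ltn_ord. Qed.

Lemma grevlex_ltE : weight_lt n.+1 grevlex_weight = @grevlex_lt n.
Proof.
apply/funext => alpha; apply/funext => beta; apply/propext; split.
  case=> -[|k] [km kE klt]; first by left; rewrite -!grevlex_weight0.
  right; rewrite -!grevlex_weight0; split; first exact: kE.
  (* The sums of the first n - k exponents agree, so a smaller sum of the first n - k - 1 means a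
     larger exponent at position n - k - 1: this is the reversal. *)
  have in' : (n - k.+1 < n)%N by lia.
  exists (Ordinal in'); split=> [j /= jk|].
    have jn := ltn_ord j.
    have E1 := @grevlex_weightS alpha j (n - j.+1) ltac:(lia).
    have E2 := @grevlex_weightS beta j (n - j.+1) ltac:(lia).
    have := kE (n - j.+1)%N ltac:(lia); have := kE (n - j.+1).+1%N ltac:(lia); lia.
  have E1 := @grevlex_weightS alpha (Ordinal in') k ltac:(rewrite /=; lia).
  have E2 := @grevlex_weightS beta (Ordinal in') k ltac:(rewrite /=; lia).
  have := kE k (ltnSn _); lia.
case=> [dlt|[dE [i [iE ilt]]]]; first by exists 0%N; rewrite !grevlex_weight0.
have iN := ltn_ord i.
have E j : (j < n - i)%N -> weight (grevlex_weight j) alpha = weight (grevlex_weight j) beta.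
  elim: j => [|j IH] jn; first by rewrite !grevlex_weight0.
  have jn' : (n - j.+1 < n)%N by lia.
  have E1 := @grevlex_weightS alpha (Ordinal jn') j ltac:(rewrite /=; lia).
  have E2 := @grevlex_weightS beta (Ordinal jn') j ltac:(rewrite /=; lia).
  have := IH ltac:(lia); have := iE (Ordinal jn') ltac:(rewrite /=; lia); lia.
(* This weight sums the exponents strictly before position [i]. For [i] = 0 its index is n, which is
   why n + 1 weights are taken. *)
exists (n - i)%N; split=> //; first lia.
have E1 := @grevlex_weightS alpha i (n - i.+1) ltac:(lia).
have E2 := @grevlex_weightS beta i (n - i.+1) ltac:(lia).
have -> : (n - i = (n - i.+1).+1)%N by lia.
have := E (n - i.+1)%N ltac:(lia); lia.
Qed.

Lemma grevlex_separating : weight_separating n.+1 grevlex_weight.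
Proof.
move=> alpha beta E; apply/ffunP => j; have jn := ltn_ord j.
suff: alpha j = beta j by [].
have E1 := @grevlex_weightS alpha j (n - j.+1) ltac:(lia).
have E2 := @grevlex_weightS beta j (n - j.+1) ltac:(lia).
have := E (n - j.+1)%N ltac:(lia); have := E (n - j.+1).+1%N ltac:(lia); lia.
Qed.

Lemma exponent_ordering_weight (lt : {ffun 'I_n -> nat} -> {ffun 'I_n -> nat} -> Prop) :
  [\/ lt = @lex_lt n, lt = @grlex_lt n | lt = @grevlex_lt n] ->
  exists m p, weight_separating m p /\ lt = weight_lt m p.
Proof.
case=> ->.
- by exists n, (fun k i => val i == k); split; [exact: lex_separating|rewrite lex_ltE].
- by exists n.+1, grlex_weight; split; [exact: grlex_separating|rewrite grlex_ltE].
- by exists n.+1, grevlex_weight; split; [exact: grevlex_separating|rewrite grevlex_ltE].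
Qed.

Lemma degree_exp_one i : degree (exp_one i) = 1%N.
Proof.
rewrite /degree (bigD1 i) //= ffunE eqxx big1 // => j ji.
by rewrite ffunE (negbTE ji).
Qed.

Lemma exponent_ordering_exp_one (lt : {ffun 'I_n -> nat} -> {ffun 'I_n -> nat} -> Prop) :
  [\/ lt = @lex_lt n, lt = @grlex_lt n | lt = @grevlex_lt n] ->
  forall i j : 'I_n, (i < j)%N -> lt (exp_one j) (exp_one i).
Proof.
move=> ltE i j ij.
have lexij : lex_lt (exp_one j) (exp_one i).
  by exists i; split=> [k ki|]; rewrite !ffunE -!val_eqE /=; lia.
case: ltE => -> //; right; rewrite !degree_exp_one; split=> //.
by exists j; split=> [k ki|]; rewrite !ffunE -!val_eqE /=; lia.
Qed.

End WeightOrderings.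

(** * Words in the generators *)

Section Words.
Variable n : nat.
Implicit Types (r s : seq 'I_n) (alpha beta : {ffun 'I_n -> nat}).

Definition leo : rel 'I_n := fun i j => (i <= j)%N.

Lemma leo_trans : transitive leo. Proof. by move=> ? ? ?; apply: leq_trans. Qed.
Lemma leo_refl : reflexive leo. Proof. by move=> ?; apply: leqnn. Qed.

Definition exp_word alpha : seq 'I_n :=
  flatten [seq nseq (alpha i) i | i <- enum 'I_n].

Definition word_exp r : {ffun 'I_n -> nat} := [ffun i => count_mem i r].

Lemma count_exp_word alpha i : count_mem i (exp_word alpha) = alpha i.
Proof.
rewrite /exp_word count_flatten -map_comp sumnE big_map big_enum /= (bigD1 i) //=.
rewrite count_nseq /= eqxx mul1n big1 ?addn0 // => j ji.
by rewrite count_nseq /= (negbTE ji).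
Qed.

Lemma sorted_exp_word alpha : sorted leo (exp_word alpha).
Proof.
rewrite (sorted_pairwise leo_trans) /exp_word.
have : sorted leo (enum 'I_n).
  have := iota_sorted 0 n; rewrite -val_enum_ord sorted_map.
  exact: sub_sorted.
rewrite (sorted_pairwise leo_trans); elim: (enum 'I_n) => //= i s IH /andP[his hs].
rewrite pairwise_cat IH // andbT; apply/andP; split.
  apply/allrelP => j k /nseqP[-> _] /flatten_mapP[k' /(allP his) ik' /nseqP[-> _]] //.
by elim: (alpha i) => //= m ->; rewrite andbT; apply/allP => j /nseqP[-> _]; apply: leo_refl.
Qed.

Lemma sorted_wordE r : sorted leo r -> r = exp_word (word_exp r).
Proof.
move=> rs; apply: (sorted_eq leo_trans) => //.
- by move=> i j ij; apply: val_inj; apply/eqP; rewrite eqn_leq.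
- exact: sorted_exp_word.
- by apply/allP => i _; rewrite /= count_exp_word ffunE.
Qed.

(** Sortedness is a condition on neighbours, so its failure exhibits an adjacent descent; in a
    monomial this is an occurrence of the leading monomial of a relation. *)
Lemma not_sorted_word r : ~~ sorted leo r ->
  exists s (i j : 'I_n) t, (i < j)%N /\ r = s ++ [:: j; i] ++ t.
Proof.
elim: r => // j r IH; case: r IH => //= i r IH.
rewrite negb_and => /orP[|/IH [s [i' [j' [t [ij E]]]]]].
  by rewrite -ltnNge => ij; exists [::], i, j, r.
by exists (j :: s), i', j', t; rewrite E.
Qed.

Section WordProducts.
Variables (S : pzRingType) (b : 'I_n -> S).

Lemma prod_exp_word alpha :
  \prod_(i <- exp_word alpha) b i = \prod_(i < n) b i ^+ alpha i.
Proof.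
rewrite /exp_word big_flatten big_map enumT [index_enum _]unlock.
apply: eq_bigr => i _; elim: (alpha i) => [|m IH] /=; first by rewrite big_nil.
by rewrite big_cons IH exprS.
Qed.

Lemma prod_powers_word (s : seq ('I_n * nat)) :
  exists r, \prod_(p <- s) b p.1 ^+ p.2 = \prod_(i <- r) b i.
Proof.
exists (flatten [seq nseq p.2 p.1 | p <- s]).
rewrite big_flatten big_map; apply: eq_bigr => -[i m] _ /=.
elim: m => [|m IH]; first by rewrite big_nil.
by rewrite /= big_cons -IH exprS.
Qed.

End WordProducts.

Section QuasiCommutation.
Variables (K : fieldType) (A : pzAlgType K) (b : 'I_n -> A) (lam : 'I_n -> 'I_n -> K).
Hypothesis bC : forall i j : 'I_n, (i < j)%N -> b j * b i = scal (lam j i) (b i * b j).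

(** Insertion sort: every exchange of a descent costs a factor [lam], which may be zero, so [c] may
    vanish. *)
Lemma prod_word_sort r : exists c s,
  [/\ sorted leo s, perm_eq r s & \prod_(i <- r) b i = scal c (\prod_(i <- s) b i)].
Proof.
have ins i s : sorted leo s -> exists c t, [/\ sorted leo t, perm_eq (i :: s) t
    & b i * \prod_(k <- s) b k = scal c (\prod_(k <- t) b k)].
  elim: s => [_|h s IH hs].
    by exists 1, [:: i]; rewrite scal1 big_nil big_seq1 mulr1.
  case: (leqP i h) => [ih|hi].
    by exists 1, [:: i, h & s]; rewrite scal1 [in RHS]big_cons /= /leo ih.
  have [c [t [ts pt E]]] := IH (path_sorted hs).
  exists (lam i h * c), (h :: t); split.
  - rewrite /= (path_sortedE leo_trans) ts andbT -(perm_all _ pt) /= {1}/leo (ltnW hi).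
    by apply: order_path_min hs; apply: leo_trans.
  - by rewrite -[[:: i, h & s]]/([:: i] ++ [:: h] ++ s) perm_catCA perm_cons.
  - by rewrite !big_cons mulrA bC // -scalAl -mulrA E -scalAr scalA.
elim: r => [|i r [c [s [ss ps E]]]].
  by exists 1, [::]; rewrite scal1.
have [d [t [ts pt E']]] := ins i s ss.
exists (c * d), t; split=> //.
  by apply: perm_trans pt; rewrite perm_cons.
by rewrite big_cons E -scalAr E' scalA.
Qed.

Lemma prod_powers_mul alpha beta : exists c : K,
  (\prod_(i < n) b i ^+ alpha i) * (\prod_(i < n) b i ^+ beta i)
  = scal c (\prod_(i < n) b i ^+ exp_add alpha beta i).
Proof.
have [c [s [ss ps E]]] := prod_word_sort (exp_word alpha ++ exp_word beta).
exists c; rewrite -!prod_exp_word -big_cat E (sorted_wordE ss).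
suff -> : word_exp s = exp_add alpha beta by [].
apply/ffunP => i; rewrite !ffunE -(seq.permP ps) count_cat.
by rewrite !count_exp_word.
Qed.

End QuasiCommutation.
End Words.

(** * Bases and leading monomials *)

Section Scalars.
Variables (K : fieldType) (A : pzAlgType K).
Implicit Types (c d : K) (x y : A).

Lemma scal0r c : scal c (0 : A) = 0.
Proof. by apply: (addIr (scal c 0)); rewrite -scalDr !add0r. Qed.

Lemma scal0l x : scal 0 x = 0.
Proof. by apply: (addIr (scal 0 x)); rewrite -scalDl !add0r. Qed.

Lemma scalNl c x : scal (- c) x = - scal c x.
Proof. by apply: (addIr (scal c x)); rewrite -scalDl !addNr scal0l. Qed.

Lemma scalK c x : c != 0 -> scal c^-1 (scal c x) = x.
Proof. by move=> c0; rewrite scalA mulVf // scal1. Qed.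

Lemma sum_extend (s t : seq A) (c : A -> K) : uniq s -> uniq t -> {subset s <= t} ->
  \sum_(u <- t) scal (if u \in s then c u else 0) u = \sum_(u <- s) scal (c u) u.
Proof.
move=> us ut st; rewrite (bigID (mem s)) /= [X in _ + X]big1 ?addr0; last first.
  by move=> u /negbTE ->; rewrite scal0l.
rewrite -big_filter (perm_big s) /=.
  by apply: eq_big_seq => u ->.
apply: uniq_perm => // [|u]; first exact: filter_uniq.
by rewrite mem_filter andb_idr //; apply: st.
Qed.

(** The spanning clause of [is_basis] allows repeated entries, while [is_leading] needs distinct
    ones; closure under sums merges the repetitions. *)
Definition uniq_span (B : set A) (f : A) := exists (s : seq A) (c : A -> K),
  [/\ uniq s, forall u, u \in s -> B u & f = \sum_(u <- s) scal (c u) u].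

Lemma uniq_spanD B f h : uniq_span B f -> uniq_span B h -> uniq_span B (f + h).
Proof.
move=> [s [c [us sB ->]]] [t [d [ut tB ->]]].
pose w := undup (s ++ t).
exists w, (fun u => (if u \in s then c u else 0) + (if u \in t then d u else 0)).
split; first exact: undup_uniq.
  by move=> u; rewrite mem_undup mem_cat => /orP[/sB|/tB].
under [RHS]eq_bigr do rewrite scalDl.
by rewrite big_split /= !sum_extend ?undup_uniq // => u ut';
  rewrite mem_undup mem_cat ut' ?orbT.
Qed.

Lemma uniq_span_scal (B : set A) c u : B u -> uniq_span B (scal c u).
Proof.
move=> Bu; exists [:: u], (fun=> c); split=> // [v|]; first by rewrite inE => /eqP ->.
by rewrite big_seq1.
Qed.

Lemma uniq_span0 B : uniq_span B 0.
Proof. by exists [::], (fun=> 0); split=> //; rewrite big_nil. Qed.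

Lemma uniq_span_sum (T : eqType) B (s : seq T) (F : T -> A) :
  (forall u, u \in s -> uniq_span B (F u)) -> uniq_span B (\sum_(u <- s) F u).
Proof.
elim: s => [_|u s IH sB]; first by rewrite big_nil; apply: uniq_span0.
rewrite big_cons; apply: uniq_spanD; first by apply: sB; rewrite mem_head.
by apply: IH => v vs; apply: sB; rewrite inE vs orbT.
Qed.

Section Basis.
Variables (B : set A) (prec : A -> A -> Prop).
Hypothesis basisB : is_basis B.

Lemma basis_neq0 u : B u -> u <> 0.
Proof.
move=> Bu u0; have := (basisB.1 [:: u] (fun=> 1)) isT.
have H1 v : v \in [:: u] -> B v by rewrite inE => /eqP ->.
move=> /(_ H1); rewrite big_seq1 scal1 => /(_ u0 u); rewrite inE eqxx => /(_ isT).
by move/eqP; rewrite oner_eq0.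
Qed.

(** Over the union of both supports the difference is a vanishing combination, so a nonzero [c u]
    must be cancelled by a term of [t]. *)
Lemma basis_coef (s t : seq A) (c d : A -> K) u :
  uniq s -> uniq t -> (forall v, v \in s -> B v) -> (forall v, v \in t -> B v) ->
  \sum_(v <- s) scal (c v) v = \sum_(v <- t) scal (d v) v ->
  u \in s -> c u != 0 -> u \in t.
Proof.
move=> us ut sB tB E uins cu.
pose w := undup (s ++ t).
have wB v : v \in w -> B v by rewrite mem_undup mem_cat => /orP[/sB|/tB].
have := basisB.1 w (fun v => (if v \in s then c v else 0) - (if v \in t then d v else 0))
  (undup_uniq _) wB.
have -> : \sum_(v <- w)
    scal ((if v \in s then c v else 0) - (if v \in t then d v else 0)) v = 0.
  under eq_bigr do rewrite scalDl scalNl.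
  rewrite big_split /= sumrN !sum_extend ?undup_uniq // ?E ?subrr // => v vt;
  by rewrite mem_undup mem_cat vt ?orbT.
move=> /(_ erefl u); rewrite mem_undup mem_cat uins => /(_ isT).
by case: ifP => // _ /eqP; rewrite subr0 (negbTE cu).
Qed.

Hypothesis woB : well_ordering B prec.

Lemma leading_uniq f u v : is_leading B prec f u -> is_leading B prec f v -> u = v.
Proof.
move=> [s [c [us sB fs uins su]]] [t [d [ut tB ft vint tv]]].
have [irr tr _ _] := woB.
have sB' w : w \in s -> B w by case/sB.
have tB' w : w \in t -> B w by case/tB.
have Bu := sB' _ uins; have Bv := tB' _ vint.
have ut' : u \in t.
  by apply: (basis_coef us ut sB' tB' _ uins); [exact: (etrans (esym fs) ft) | case: (sB _ uins)].
have vs' : v \in s.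
  by apply: (basis_coef ut us tB' sB' _ vint); [exact: (etrans (esym ft) fs) | case: (tB _ vint)].
apply: contrapT => uv; case: (irr u Bu); apply: (tr u v u) => //; first exact: tv.
by apply: su => // vu; apply: uv.
Qed.

Lemma LM_eq f u : is_leading B prec f u -> LM B prec f = u.
Proof.
by move=> fu; apply: xget_unique => // v fv; apply: leading_uniq fv fu.
Qed.

Lemma LM_leading f : LM B prec f <> 0 -> is_leading B prec f (LM B prec f).
Proof. by rewrite /LM; case: xgetP => // u ->. Qed.

Lemma LM_scal c u : c != 0 -> B u -> LM B prec (scal c u) = u.
Proof.
move=> c0 Bu; apply: LM_eq; exists [:: u], (fun=> c); split=> //.
- by move=> v; rewrite inE => /eqP ->.
- by rewrite big_seq1.
- by rewrite inE.
- by move=> v; rewrite inE => /eqP.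
Qed.

Lemma LM_basis u : B u -> LM B prec u = u.
Proof. by move=> Bu; rewrite -{1}[u]scal1 LM_scal ?oner_eq0. Qed.

Lemma LM0 : LM B prec 0 = 0.
Proof.
apply: xgetPN => u [s [c [us sB E uins _]]].
have sB' w : w \in s -> B w by case/sB.
have nB w : w \in [::] -> B w by [].
have [_ cu] := sB _ uins.
by have := basis_coef (t := [::]) (d := fun=> 0) us isT sB' nB _ uins cu; rewrite big_nil => /(_ (esym E)).
Qed.

(** Terms with zero coefficient are discarded first; [u0] guarantees that one remains, and a
    nonempty finite part of [B] has a greatest element. *)
Lemma exists_leading (s : seq A) (c : A -> K) u0 :
  uniq s -> (forall u, u \in s -> B u) -> u0 \in s -> c u0 != 0 ->
  exists2 u, u \in s & is_leading B prec (\sum_(v <- s) scal (c v) v) u.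
Proof.
move=> us sB u0s cu0; have [_ tr tot _] := woB.
pose t := [seq v <- s | c v != 0].
have tB v : v \in t -> B v by rewrite mem_filter => /andP[_ /sB].
have [u ut umax] : exists2 u, u \in t & forall v, v \in t -> v <> u -> prec v u.
  have : t != [::].
    have : u0 \in t by rewrite mem_filter cu0.
    by case: (t).
  elim: (t) tB => // v r IH rB _; case: r IH rB => [_ _|v' r IH rB].
    by exists v; rewrite ?inE // => w; rewrite inE => /eqP.
  have rB' w : w \in v' :: r -> B w by move=> wr; apply: rB; rewrite inE wr orbT.
  have [u ur umax] := IH rB' isT.
  have Bv : B v by apply: rB; rewrite mem_head.
  have Bu := rB' _ ur.
  case: (tot v u Bv Bu) => [vu|vu|uv].
  - exists u; first by rewrite inE ur orbT.
    by move=> w; rewrite inE => /predU1P[->//|]; apply: umax.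
  - exists u; first by rewrite inE ur orbT.
    by move=> w; rewrite inE => /predU1P[->//|]; apply: umax.
  - exists v; first exact: mem_head.
    move=> w; rewrite inE => /predU1P[->//|wr] _.
    case: (pselect (w = u)) => [->//|/(umax _ wr) wu].
    exact: (tr w u v (rB' _ wr) Bu Bv wu uv).
exists u; first by move: ut; rewrite mem_filter => /andP[].
exists t, c; split=> //; first exact: filter_uniq.
- by move=> v vt; split; [exact: tB | move: vt; rewrite mem_filter => /andP[]].
- rewrite big_filter (bigID (fun v => c v != 0)) /= [X in _ + X]big1 ?addr0 //.
  by move=> v /negPn/eqP ->; rewrite scal0l.
Qed.

Lemma LM_in_basis f : f <> 0 -> B (LM B prec f).
Proof.
have [s [c [us sB ->]]] : uniq_span B f.
  have [s [c [sB ->]]] := basisB.2 f.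
  by apply: uniq_span_sum => u uins; apply/uniq_span_scal/sB.
move=> f0; have [u uins cu] : exists2 u, u \in s & c u != 0.
  apply: contrapT => nex; apply: f0; rewrite big_seq big1 // => u uins.
  apply: contrapT => cu; apply: nex; exists u => //.
  by apply/eqP => c0; apply: cu; rewrite c0 scal0l.
have [v vs lead] := exists_leading us sB uins cu.
by rewrite (LM_eq lead); apply: sB.
Qed.

Lemma LM_binomial c d u v : B u -> B v -> prec u v -> d != 0 ->
  LM B prec (scal c u + scal d v) = v.
Proof.
move=> Bu Bv uv d0; have [irr _ _ _] := woB.
case: (eqVneq c 0) => [->|c0]; first by rewrite scal0l add0r LM_scal.
have nuv : u != v by apply/eqP => E; apply: (irr v) => //; rewrite -{1}E.
apply: LM_eq; exists [:: u; v], (fun w => if w == v then d else c); split.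
- by rewrite /= inE nuv.
- move=> w; rewrite !inE => /orP[]/eqP->; split=> //; first by rewrite (negbTE nuv).
  by rewrite eqxx.
- by rewrite big_cons big_seq1 eqxx (negbTE nuv).
- by rewrite !inE eqxx orbT.
- by move=> w; rewrite !inE => /orP[]/eqP->.
Qed.

End Basis.

(** * Products of basis elements and their compatibility with the ordering *)

Section SkewMonomials.
Variables (B : set A) (prec : A -> A -> Prop).
Hypothesis basisB : is_basis B.
Hypothesis mulB : forall u v, B u -> B v ->
  u * v = 0 \/ exists (c : K) w, [/\ c != 0, B w & u * v = scal c w].

(** The coefficient may be zero, so that these elements, unlike those of [B], are closed under
    multiplication. *)
Definition skew_monomial x := exists (c : K) (w : A), B w /\ x = scal c w.

Lemma skew_monomialW u : B u -> skew_monomial u.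
Proof. by move=> Bu; exists 1, u; rewrite scal1. Qed.

Lemma skew_monomialM x y : skew_monomial x -> skew_monomial y -> skew_monomial (x * y).
Proof.
move=> [c [u [Bu ->]]] [d [v [Bv ->]]].
rewrite -scalAl -scalAr scalA; case: (mulB Bu Bv) => [->|[e [w [_ Bw ->]]]].
  by exists 0, u; rewrite scal0r scal0l.
by exists (c * d * e), w; rewrite scalA.
Qed.

Lemma skew_monomialP x : skew_monomial x ->
  x = 0 \/ exists c w, [/\ c != 0, B w & x = scal c w].
Proof.
move=> [c [w [Bw ->]]]; case: (eqVneq c 0) => [->|c0]; first by left; rewrite scal0l.
by right; exists c, w.
Qed.

(** Since [v] is nonzero, so are the cofactors, and their coefficients can be moved into [c].
    Divisibility may thus be checked with arbitrary products as cofactors. *)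
Lemma monomial_divides_skew c x y u v : skew_monomial x -> skew_monomial y ->
  B v -> c != 0 -> v = scal c (x * u * y) -> monomial_divides B u v.
Proof.
move=> sx sy Bv c0 E.
case: (skew_monomialP sx) => [x0|[d [x' [d0 Bx' xE]]]].
  by case: (basis_neq0 basisB Bv); rewrite E x0 !mul0r scal0r.
case: (skew_monomialP sy) => [y0|[e [y' [e0 By' yE]]]].
  by case: (basis_neq0 basisB Bv); rewrite E y0 mulr0 scal0r.
exists (c * d * e), x', y'; split=> //; first by rewrite !mulf_neq0.
by rewrite E xE yE -!scalAl -scalAr !scalA -mulrA.
Qed.

Lemma monomial_divides_trans u v w : B w ->
  monomial_divides B u v -> monomial_divides B v w -> monomial_divides B u w.
Proof.
move=> Bw [c [x [y [c0 Bx By ->]]]] [d [x' [y' [d0 Bx' By' E]]]].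
apply: (@monomial_divides_skew (d * c) (x' * x) (y * y')) => //.
- by apply: skew_monomialM; apply: skew_monomialW.
- by apply: skew_monomialM; apply: skew_monomialW.
- by rewrite mulf_neq0.
- by rewrite E -scalAr -scalAl scalA !mulrA.
Qed.

Section MonomialOrdering.
Hypothesis ordB : two_sided_monomial_ordering B prec.
Hypothesis B1 : B 1.

Let woB : well_ordering B prec. Proof. by case: ordB. Qed.

(** The second ordering axiom is applied to [u] as the leading monomial of u * 1 * 1. *)
Lemma prec1 u : B u -> u = 1 \/ prec 1 u.
Proof.
move=> Bu; case: (pselect (u = 1)) => u1; first by left.
right; have [_ _ mo2] := ordB; apply: (mo2 1 u u 1) => //; first by left.
by rewrite !mulr1 LM_basis.
Qed.

Lemma not_prec1 u : B u -> ~ prec u 1.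
Proof.
move=> Bu u1; have [irr tr _ _] := woB.
case: (prec1 Bu) => [E|]; first by apply: (irr 1) => //; rewrite -{1}E.
by move=> pu; apply: (irr u) => //; apply: tr pu.
Qed.

Lemma basis_scal1 c u : B u -> u = scal c 1 -> u = 1.
Proof.
move=> Bu E; have c0 : c != 0.
  by apply/eqP => c0; apply: (basis_neq0 basisB Bu); rewrite E c0 scal0l.
by rewrite -(LM_basis basisB woB Bu) E LM_scal.
Qed.

(** If a cofactor differed from 1, the second ordering axiom would put [q] below 1, the least
    element. *)
Lemma mul_eq1 x y q c : B x -> B y -> B q -> c != 0 -> x * q * y = scal c 1 ->
  [/\ x = 1, y = 1 & q = 1].
Proof.
move=> Bx By Bq c0 E; have [_ _ mo2] := ordB.
have LM1 : 1 = LM B prec (x * q * y) by rewrite E LM_scal.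
case: (pselect (x <> 1 \/ y <> 1)) => [xy|].
  by case: (not_prec1 Bq); apply: (mo2 q 1 x y).
move/not_orP => [/contrapT x1 /contrapT y1]; split=> //.
by apply: (basis_scal1 (c := c)) => //; rewrite -E x1 y1 mul1r mulr1.
Qed.

Lemma is_scalar_basis u : B u -> is_scalar u -> u = 1.
Proof. by move=> Bu [c]; apply: basis_scal1. Qed.

(** The first ordering axiom covers non-scalar [t] and [w]. The rest is direct: [w] = 1 would force
    [q] = 1 and put [p] below 1, and a scalar [t] is 1, which lies below [w]. *)
Lemma prec_mul x y p q c d t w : B x -> B y -> B p -> B q -> B t -> B w ->
  c != 0 -> d != 0 -> prec p q ->
  x * q * y = scal c w -> x * p * y = scal d t -> prec t w.
Proof.
move=> Bx By Bp Bq Bt Bw c0 d0 pq Eq Ep.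
have wn1 : w <> 1.
  move=> w1; rewrite w1 in Eq; have [_ _ q1] := mul_eq1 Bx By Bq c0 Eq.
  by apply: (not_prec1 Bp); rewrite -q1.
case: (pselect (is_scalar t)) => [/(is_scalar_basis Bt) ->|ts].
  by case: (prec1 Bw).
have [_ mo1 _] := ordB.
have := mo1 p q x y Bp Bq Bx By pq; rewrite Eq Ep !LM_scal //; apply=> //.
by move/(is_scalar_basis Bw).
Qed.

End MonomialOrdering.
End SkewMonomials.
End Scalars.

Section OrderedMonomials.
Variables (K : fieldType) (A : pzAlgType K) (n : nat) (b : 'I_n -> A) (l : 'S_n).

Lemma ordered_monomial0 : ordered_monomial b l [ffun=> 0%N] = 1.
Proof. by rewrite /ordered_monomial big1 // => i _; rewrite ffunE. Qed.

Lemma ordered_monomial1 i : ordered_monomial b l (exp_one i) = b (l i).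
Proof.
rewrite /ordered_monomial (@big_only1 _ _ _ _ i) // ?ffunE ?eqxx // => j ji _.
by rewrite ffunE (negbTE ji).
Qed.

Lemma sorted_word_monomial r : sorted (@leo n) r ->
  \prod_(i <- r) b (l i) = ordered_monomial b l (word_exp r).
Proof. by move=> /sorted_wordE {1}->; rewrite (prod_exp_word (fun i => b (l i))). Qed.

End OrderedMonomials.

(** * Induced orderings *)

Section InducedOrdering.
Variables (K : fieldType) (A : pzAlgType K) (n : nat) (b : 'I_n -> A) (l : 'S_n).
Variable M : set A.
Local Notation om := (ordered_monomial b l).
Hypothesis basisM : is_basis M.
Hypothesis M_om : forall x, M x -> exists alpha, x = om alpha.
Hypothesis om_M : forall alpha, om alpha <> 0 -> M (om alpha).
Hypothesis om_inj : forall alpha beta, M (om alpha) -> om alpha = om beta -> alpha = beta.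
Hypothesis om_mul : forall alpha beta, exists c : K,
  om alpha * om beta = scal c (om (exp_add alpha beta)).
Variables (m : nat) (p : nat -> pred 'I_n).
Hypothesis sep : weight_separating m p.
Local Notation lt := (weight_lt m p).
Local Notation ltM := (induced_ordering b l M lt).

(** The existential in [induced_ordering] collapses because [om_inj] makes the exponents of an
    element of [M] unique. *)
Lemma induced_orderingE alpha beta : M (om alpha) -> M (om beta) ->
  ltM (om alpha) (om beta) = lt alpha beta.
Proof.
move=> Ma Mb; apply/propext; split; last by move=> ab; split=> //; exists alpha, beta.
case=> _ _ [alpha' [beta' [Ea Eb]]].
by rewrite (om_inj Ma Ea) (om_inj Mb Eb).
Qed.

Lemma induced_well_ordering : well_ordering M ltM.
Proof.
split.
- move=> u Mu; case: (M_om Mu) => alpha uE; rewrite uE in Mu *.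
  by rewrite induced_orderingE //; apply: weight_lt_irr.
- move=> u v w Mu Mv Mw.
  case: (M_om Mu) (M_om Mv) (M_om Mw) => al uE [be vE] [ga wE]; subst u v w.
  by rewrite !induced_orderingE //; apply: weight_lt_trans.
- move=> u v Mu Mv.
  case: (M_om Mu) (M_om Mv) => al uE [be vE]; subst u v.
  rewrite !induced_orderingE //.
  by case: (weight_lt_total sep al be) => [|->|]; [constructor 1 | constructor 2 | constructor 3].
- move=> C CM [x0 Cx0].
  case: (M_om (CM _ Cx0)) => al0 E0.
  have [|mu Cmu muP] := @weight_lt_min _ _ _ sep [set al | C (om al)].
    by exists al0; rewrite /= -E0.
  exists (om mu) => // u Cu; case: (M_om (CM _ Cu)) => al uE; subst u => nal.
  rewrite induced_orderingE; [|exact: CM|exact: CM].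
  by apply: muP => // E; apply: nal; rewrite E.
Qed.

Lemma om_mul3 al be ga : exists c : K,
  om al * om be * om ga = scal c (om (exp_add (exp_add al be) ga)).
Proof.
have [c E] := om_mul al be; have [d E'] := om_mul (exp_add al be) ga.
by exists (c * d); rewrite E -scalAl E' scalA.
Qed.

Lemma LM_om_mul3 al be ga : LM M ltM (om al * om be * om ga) = 0 \/
  M (om (exp_add (exp_add al be) ga)) /\
  LM M ltM (om al * om be * om ga) = om (exp_add (exp_add al be) ga).
Proof.
have [c ->] := om_mul3 al be ga.
case: (eqVneq c 0) => [->|c0]; first by left; rewrite scal0l LM0 //.
case: (eqVneq (om (exp_add (exp_add al be) ga)) 0) => [->|/eqP/om_M Mg].
  by left; rewrite scal0r LM0.
by right; rewrite LM_scal //; apply: induced_well_ordering.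
Qed.

Lemma is_scalar0 : is_scalar (0 : A). Proof. by exists 0; rewrite scal0l. Qed.

Lemma induced_monomial_ordering : two_sided_monomial_ordering M ltM.
Proof.
split; first exact: induced_well_ordering.
- move=> w u v s Mw Mu Mv Ms.
  case: (M_om Mw) (M_om Mu) (M_om Mv) (M_om Ms) => be wE [ga uE] [al vE] [de sE].
  subst w u v s; rewrite induced_orderingE // => bega.
  (* Zero counts as a scalar, so vanishing products are exempt from the first axiom. *)
  case: (LM_om_mul3 al be de) => [->|[M1 ->]]; first by case; apply: is_scalar0.
  case: (LM_om_mul3 al ga de) => [->|[M2 ->]]; first by move=> _; case; apply: is_scalar0.
  by move=> _ _; rewrite induced_orderingE //; apply: weight_lt_add.
- move=> w u v s Mw Mu Mv Ms vs1.
  case: (M_om Mw) (M_om Mv) (M_om Ms) => be wE [al vE] [de sE]; subst w v s.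
  case: (LM_om_mul3 al be de) => [->|[M1 ->]] uE.
    by case: (basis_neq0 basisM Mu).
  rewrite uE induced_orderingE //; apply: weight_lt_addl => //.
  by case: vs1 => n1; [left|right] => E; apply: n1; rewrite E ordered_monomial0.
Qed.

End InducedOrdering.

(** * Normal monomials and the quotient algebra *)

Section IdealQuotient.
Variables (K : fieldType) (R : algType K) (I : ideal R).
Local Notation J := (ideal_set I).

Lemma ideal_set0 : J 0. Proof. by case: (idealP I). Qed.

Lemma ideal_setD x y : J x -> J y -> J (x + y).
Proof. by case: (idealP I) => _ + _ _; apply. Qed.

Lemma ideal_setMl r x : J x -> J (r * x).
Proof. by case: (idealP I) => _ _ + _; apply. Qed.

Lemma ideal_setMr r x : J x -> J (x * r).
Proof. by case: (idealP I) => _ _ _; apply. Qed.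

Lemma ideal_set_scal c x : J x -> J (scal c x).
Proof. by move=> Ix; rewrite -[x]mul1r scalAl; apply: ideal_setMl. Qed.

Lemma quot_class0 : quot_class I 0 = 0.
Proof. exact: raddf0. Qed.

Lemma quot_classM x y : quot_class I (x * y) = quot_class I x * quot_class I y.
Proof. exact/esym/quot_mulE. Qed.

Lemma quot_class_scal c x : quot_class I (scal c x) = scal c (quot_class I x).
Proof. exact/esym/quot_scaleE. Qed.

Lemma quot_class_eq0 x : quot_class I x = 0 <-> J x.
Proof. by rewrite -quot_class0 quot_classP subr0. Qed.

Lemma quot_class_sum (T : Type) (s : seq T) (F : T -> R) :
  quot_class I (\sum_(i <- s) F i) = \sum_(i <- s) quot_class I (F i).
Proof. exact: raddf_sum. Qed.

Lemma quot_classX x m : quot_class I (x ^+ m) = quot_class I x ^+ m.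
Proof. by elim: m => [//|m IH]; rewrite !exprS quot_classM IH. Qed.

Lemma quot_class_ordered_monomial n (a : 'I_n -> R) l alpha :
  ordered_monomial (fun i => quot_class I (a i)) l alpha =
  quot_class I (ordered_monomial a l alpha).
Proof.
rewrite /ordered_monomial (big_morph _ quot_classM (erefl _)).
by apply: eq_bigr => i _; rewrite quot_classX.
Qed.

End IdealQuotient.

Section NormalMonomials.
Variables (K : fieldType) (R : algType K) (n : nat) (a : 'I_n -> R).
Variables (B : set R) (prec : R -> R -> Prop) (l : 'S_n).
Variables (Omega : set R) (lambda : 'I_n -> 'I_n -> K).
Let g (j i : 'I_n) := a (l j) * a (l i) - lambda j i *: (a (l i) * a (l j)).
Variable I : ideal R.
Local Notation J := (ideal_set I).
Let G := [set h | exists i j : 'I_n, (i < j)%N /\ h = g j i].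
Let N := normal_monomials B prec I.
Hypothesis R_admissible : two_sided_admissible_system a B prec.
Hypothesis B_ordered : forall alpha, B (ordered_monomial a l alpha).
Hypothesis Omega_monomials : Omega `<=` B.
Hypothesis LM_g : forall i j : 'I_n, (i < j)%N -> LM B prec (g j i) = a (l j) * a (l i).
Hypothesis GBI : groebner_basis B prec I (Omega `|` G).

Let basisB : is_basis B. Proof. by case: R_admissible => -[]. Qed.
Let mulB u v : B u -> B v -> u * v = 0 \/ exists (c : K) w, [/\ c != 0, B w & u * v = scal c w].
Proof. by case: R_admissible => -[_ _ +] _; apply. Qed.
Let ordB : two_sided_monomial_ordering B prec. Proof. by case: R_admissible. Qed.
Let woB : well_ordering B prec. Proof. by case: ordB. Qed.
Let B1 : B 1. Proof. by rewrite -(ordered_monomial0 a l). Qed.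
Let B_gen i : B (a (l i)). Proof. by rewrite -ordered_monomial1. Qed.

Lemma commutation_neq0 (i j : 'I_n) : (i < j)%N -> g j i <> 0.
Proof. by move=> ij; case: GBI => _ + _; apply; right; exists i, j. Qed.

Lemma commutation_ideal (i j : 'I_n) : (i < j)%N -> J (g j i).
Proof. by move=> ij; case: GBI => + _ _; apply; right; exists i, j. Qed.

(** Both terms of g_ji are scalar multiples of basis elements, so its leading monomial can be
    computed in each case and compared with the prescribed one. *)
Lemma commutation_reduction (i j : 'I_n) : (i < j)%N ->
  B (a (l j) * a (l i)) /\
  (J (a (l j) * a (l i)) \/ exists c t,
    [/\ c != 0, B t, prec t (a (l j) * a (l i))
      & lambda j i *: (a (l i) * a (l j)) = scal c t]).
Proof.
move=> ij; have g0 := commutation_neq0 ij; have Ig := commutation_ideal ij.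
have LMg := LM_g ij; rewrite /g in g0 Ig LMg.
set v := a (l j) * a (l i) in g0 Ig LMg *.
set q := _ *: _ in g0 Ig LMg *.
have sv : skew_monomial B v by apply: skew_monomialM => //; apply: skew_monomialW.
have : skew_monomial B q.
  have [c [w [Bw wE]]] : skew_monomial B (a (l i) * a (l j)).
    by apply: skew_monomialM => //; apply: skew_monomialW.
  by exists (lambda j i * c), w; rewrite -scalA -wE.
move/skew_monomialP; rewrite -/v => sq.
(* If [v] vanished, the leading monomial of the nonzero g_ji would be the basis element [t], whereas
   it is prescribed to be [v]. *)
have v0 : v <> 0.
  move=> v0; case: sq => [q0|[c [t [c0 Bt qE]]]]; first by apply: g0; rewrite v0 q0 subr0.
  move: LMg; rewrite v0 qE sub0r -scalNl LM_scal ?oppr_eq0 //.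
  exact: (basis_neq0 basisB Bt).
have Bv : B v.
  have /LM_leading : LM B prec (v - q) <> 0 by rewrite LMg.
  by rewrite LMg => -[s [c [_ sB _ /sB[Bv _] _]]].
split=> //; case: sq => [q0|[c [t [c0 Bt qE]]]]; first by left; rewrite -[v]subr0 -q0.
have [irr _ tot _] := woB.
case: (tot t v Bt Bv) => [tv|tv|vt].
- by right; exists c, t.
(* Proportional terms: g_ji is (1 - c) v with 1 - c nonzero, which puts [v] itself in the ideal. *)
- left; move: g0 Ig; rewrite qE tv -{1 3}[v]scal1 -scalNl -scalDl => g0 Ig.
  have c1 : 1 - c != 0 by apply/eqP => c1; apply: g0; rewrite c1 scal0l.
  by rewrite -(scalK v c1); apply: ideal_set_scal.
- move: LMg; rewrite qE -{1}[v]scal1 -scalNl LM_binomial ?oppr_eq0 // => tv.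
  by case: (irr v Bv); rewrite -{2}tv.
Qed.

(** Normality is tested against all of I; the Groebner property and transitivity of divisibility
    reduce the test to [Omega] and [G]. *)
Lemma not_normal_dvd w : B w -> ~ N w ->
  exists2 h, (Omega `|` G) h & monomial_divides B (LM B prec h) w.
Proof.
move=> Bw nNw; apply: contrapT => nh; apply: nNw; split=> // f If f0 fw.
case: GBI => _ _ /(_ f If f0)[h GBh hf]; apply: nh; exists h => //.
exact: (monomial_divides_trans basisB mulB Bw hf fw).
Qed.

(** A divisor from [Omega] puts [w] in I. A divisor from [G] allows a_{l_j} a_{l_i} to be replaced
    inside [w] by the lower term of g_ji, and [prec_mul] shows that the result, unless zero, is
    smaller. *)
Lemma not_normal_reduction w : B w -> ~ N w -> J w \/
  exists c t, [/\ c != 0, B t, prec t w & J (w - scal c t)].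
Proof.
move=> Bw /(not_normal_dvd Bw)[h [Oh|[i [j [ij ->]]]]].
  rewrite (LM_basis basisB woB (Omega_monomials Oh)) => -[c [x [y [_ _ _ ->]]]].
  left; apply/ideal_set_scal/ideal_setMr/ideal_setMl.
  by case: GBI => + _ _; apply; left.
rewrite LM_g // => -[c [x [y [c0 Bx By wE]]]].
have [Bv red] := commutation_reduction ij; have Ig := commutation_ideal ij.
rewrite /g in Ig; set v := a (l j) * a (l i) in Bv red Ig wE *.
set q := _ *: _ in red Ig *.
case: red => [Iv|[e [t' [e0 Bt' tv qE]]]].
  by left; rewrite wE; apply/ideal_set_scal/ideal_setMr/ideal_setMl.
have Iw : J (w - scal (c * e) (x * t' * y)).
  have -> : w - scal (c * e) (x * t' * y) = scal c (x * (v - q) * y).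
    rewrite wE qE mulrBr mulrBl -scalAr -scalAl scalDr.
    by rewrite -[- scal e _]scalNl scalA mulrN scalNl.
  by apply/ideal_set_scal/ideal_setMr/ideal_setMl.
have : skew_monomial B (x * t' * y).
  by do 2?[apply: skew_monomialM => //]; apply: skew_monomialW.
case/skew_monomialP => [z|[d [t [d0 Bt tE]]]].
  by left; move: Iw; rewrite z scal0r subr0.
right; exists (c * e * d), t; split=> //; first by rewrite !mulf_neq0.
  apply: (prec_mul basisB ordB B1 Bx By Bt' Bv Bt Bw (invr_neq0 c0) d0 tv) => //.
  by rewrite wE scalK.
by rewrite -scalA -tE.
Qed.

(** A least counterexample cannot be normal, and its reduction would be a smaller counterexample. *)
Lemma normal_form w : B w -> J w \/ exists c t, [/\ c != 0, N t & J (w - scal c t)].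
Proof.
move=> Bw; apply: contrapT => nw; have [_ _ _ wf] := woB.
pose C := [set w | B w /\
  ~ (J w \/ exists c t, [/\ c != 0, N t & J (w - scal c t)])].
have [|w0 [Bw0 nw0] w0min] := wf C _ (ex_intro _ w (conj Bw nw)); first by move=> ? [].
apply: nw0; case: (pselect (N w0)) => [Nw0|/(not_normal_reduction Bw0)].
  by right; exists 1, w0; rewrite scal1 subrr oner_eq0; split=> //; apply: ideal_set0.
case=> [|[c [t [c0 Bt tw It]]]]; first by left.
have : ~ C t.
  move=> Ct; have [irr tr _ _] := woB.
  have tn : t <> w0 by move=> E; apply: (irr w0) => //; rewrite -{1}E.
  by apply: (irr t) => //; apply: (tr t w0 t) => //; apply: w0min.
move=> nCt; have : J t \/ exists c t', [/\ c != 0, N t' & J (t - scal c t')].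
  by apply: contrapT => nt; apply: nCt.
case=> [It'|[d [t' [d0 Nt' It']]]].
  by left; rewrite -(subrK (scal c t) w0); apply: ideal_setD => //; apply: ideal_set_scal.
right; exists (c * d), t'; split=> //; first by rewrite mulf_neq0.
have -> : w0 - scal (c * d) t' = (w0 - scal c t) + scal c (t - scal d t').
  by rewrite scalDr -[- scal d t']scalNl scalA mulrN scalNl addrA subrK.
by apply: ideal_setD => //; apply: ideal_set_scal.
Qed.

(** A nontrivial combination in I would have one of its normal monomials as leading monomial, and
    this divides itself with cofactors 1. *)
Lemma normal_independent (s : seq R) (c : R -> K) : uniq s -> (forall u, u \in s -> N u) ->
  J (\sum_(u <- s) scal (c u) u) -> forall u, u \in s -> c u = 0.
Proof.
move=> us sN If u0 u0s; apply/eqP; apply: contrapT => /negP cu0.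
have sB u : u \in s -> B u by case/sN.
have [u uins lead] := exists_leading woB us sB u0s cu0.
have [Bu Nu] := sN _ uins.
set f := \sum_(_ <- _) _ in If lead.
have LMf : LM B prec f = u by apply: LM_eq.
apply: (Nu f If).
  move=> f0; apply: (basis_neq0 basisB Bu); rewrite -LMf f0.
  exact: LM0.
by exists 1, 1, 1; rewrite scal1 mulr1 mul1r LMf oner_eq0.
Qed.

Lemma normal_class_inj u v : N u -> N v -> quot_class I u = quot_class I v -> u = v.
Proof.
move=> Nu Nv /quot_classP Iuv; apply/eqP/negPn/negP => nuv.
have := @normal_independent [:: u; v] (fun w => if w == u then 1 else -1).
rewrite /= inE nuv => /(_ isT) H; have /H : forall w, w \in [:: u; v] -> N w.
  by move=> w; rewrite !inE => /orP[]/eqP->.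
rewrite big_cons big_seq1 eqxx eq_sym (negbTE nuv) scal1 scalNl scal1 => /(_ Iuv u).
by rewrite mem_head eqxx => /(_ isT)/eqP; rewrite oner_eq0.
Qed.

Lemma normal_ordered : N `<=` range (ordered_monomial a l).
Proof.
move=> u [Bu Nu]; have [[_ + _] _] := R_admissible.
move=> /(_ u Bu)[s]; have [r ->] := prod_powers_word a s; move=> uE.
(* Relabelling by the inverse of [l] turns letters into positions in the permuted list of
   generators, where sortedness is meant. *)
pose r' := [seq (l^-1)%g i | i <- r].
have {}uE : u = \prod_(i <- r') a (l i).
  by rewrite uE big_map; apply: eq_bigr => i _; rewrite permKV.
case: (boolP (sorted (@leo n) r')) => [/sorted_word_monomial E|].
  by exists (word_exp r'); rewrite // -E -uE.
case/not_sorted_word => x [i [j [y [ij r'E]]]]; exfalso.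
have sw w : skew_monomial B (\prod_(i <- w) a (l i)).
  elim: w => [|k w IH]; first by rewrite big_nil; apply: skew_monomialW.
  by rewrite big_cons; apply: skew_monomialM => //; apply: skew_monomialW.
apply: (Nu _ (commutation_ideal ij) (commutation_neq0 ij)); rewrite LM_g //.
apply: (monomial_divides_skew basisB (sw x) (sw y) Bu (oner_neq0 _)).
by rewrite scal1 uE r'E !big_cat /= big_cons big_seq1 mulrA.
Qed.

Let Nbar : set (quot_alg I) := [set quot_class I u | u in N].
Let abar i := quot_class I (a i).

Lemma normal_class_mul u v : Nbar u -> Nbar v ->
  u * v = 0 \/ exists (c : K) w, [/\ c != 0, Nbar w & u * v = scal c w].
Proof.
move=> [x [Bx _] <-] [y [By _] <-]; rewrite -quot_classM.
case: (mulB Bx By) => [->|[c [w [c0 Bw ->]]]]; first by left; rewrite quot_class0.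
rewrite quot_class_scal; case: (normal_form Bw) => [/quot_class_eq0 ->|].
  by left; rewrite scal0r.
move=> [d [t [d0 Nt /quot_classP ->]]]; right; exists (c * d), (quot_class I t).
by rewrite mulf_neq0 // quot_class_scal scalA; split=> //; exists t.
Qed.

Lemma normal_class_basis : is_basis Nbar.
Proof.
split.
  move=> s c us sN E u uins.
  (* Independence is pulled back to R through a choice of normal representatives, injective because
     taking classes undoes it. *)
  pose rep x := xget 0 [set v | N v /\ quot_class I v = x].
  have repP x : x \in s -> N (rep x) /\ quot_class I (rep x) = x.
    by move=> /sN[v Nv vE]; rewrite /rep; case: xgetP => [w _ //|/(_ v)]; case.
  have := @normal_independent [seq rep x | x <- s] (fun v => c (quot_class I v)).
  have us' : uniq [seq rep x | x <- s].
    rewrite map_inj_in_uniq // => x y /repP[_ {2}<-] /repP[_ {2}<-].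
    by move->.
  have sN' v : v \in [seq rep x | x <- s] -> N v by case/mapP => x /repP[? _] ->.
  move=> /(_ us' sN') H; have := H _ (rep u).
  rewrite (repP _ uins).2; apply; last exact: map_f.
  apply/quot_class_eq0; rewrite quot_class_sum big_map -[RHS]E.
  by apply: eq_big_seq => x /repP[_ xE]; rewrite quot_class_scal xE.
elim/quot_ind=> f; have [s [c [sB ->]]] := basisB.2 f.
suff [t [d [_ tN ->]]] : uniq_span Nbar (quot_class I (\sum_(u <- s) scal (c u) u)).
  by exists t, d.
rewrite quot_class_sum; apply: uniq_span_sum => u us.
rewrite quot_class_scal; case: (normal_form (sB u us)).
  by move=> /quot_class_eq0 ->; rewrite scal0r; apply: uniq_span0.
move=> [d [t [_ Nt /quot_classP ->]]]; rewrite quot_class_scal scalA.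
by apply: uniq_span_scal; exists t.
Qed.

Lemma normal_class_skew_basis : skew_multiplicative_basis abar Nbar.
Proof.
split; [exact: normal_class_basis | | exact: normal_class_mul].
move=> _ [u Nu <-]; have [alpha _ <-] := normal_ordered Nu.
exists [seq (l i, alpha i) | i <- index_enum 'I_n].
by rewrite big_map -quot_class_ordered_monomial.
Qed.

Lemma ordered_class_mul alpha beta : exists c : K,
  ordered_monomial abar l alpha * ordered_monomial abar l beta
  = scal c (ordered_monomial abar l (exp_add alpha beta)).
Proof.
apply: (@prod_powers_mul n K (quot_alg I) (fun i => abar (l i)) lambda) => i j ij.
rewrite -!quot_classM -quot_class_scal; apply/quot_classP.
exact: commutation_ideal.
Qed.

(** * Monomial orderings on the classes of normal monomials *)

Hypothesis om_inj : injective (ordered_monomial a l).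
Hypothesis om_normal : forall alpha, ordered_monomial abar l alpha <> 0 ->
  N (ordered_monomial a l alpha).

Lemma normal_class_ordering lt :
  [\/ lt = @lex_lt n, lt = @grlex_lt n | lt = @grevlex_lt n] ->
  two_sided_monomial_ordering Nbar (induced_ordering abar l Nbar lt).
Proof.
move=> /exponent_ordering_weight[m [p [sep ->]]].
have om_class alpha : ordered_monomial abar l alpha <> 0 ->
    Nbar (ordered_monomial abar l alpha).
  move=> /om_normal Na; rewrite quot_class_ordered_monomial.
  by exists (ordered_monomial a l alpha).
apply: induced_monomial_ordering => //.
- exact: normal_class_basis.
- move=> _ [u Nu <-]; have [alpha _ <-] := normal_ordered Nu.
  by exists alpha; rewrite quot_class_ordered_monomial.
- move=> alpha beta Ma E.
  (* The common class is nonzero, being a basis element, so [om_normal] makes both ordered monomials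
     normal; equal classes then give equal monomials, and [om_inj] equal exponents. *)
  have a0 := basis_neq0 normal_class_basis Ma.
  have b0 : ordered_monomial abar l beta <> 0 by rewrite -E.
  apply: om_inj; apply: normal_class_inj; [exact: om_normal | exact: om_normal |].
  by rewrite -!quot_class_ordered_monomial.
- exact: ordered_class_mul.
Qed.

(** * Normality of the generators *)

Hypothesis GB_min : forall H, H `<` Omega `|` G -> ~ groebner_basis B prec I H.

Lemma generator_neq1 i : a (l i) <> 1.
Proof.
rewrite -(ordered_monomial0 a l) -ordered_monomial1 => /om_inj/ffunP/(_ i).
by rewrite !ffunE eqxx.
Qed.

Lemma mul_generator_neq_scalar k c w : B w -> c != 0 ->
  w * a (l k) = scal c 1 \/ a (l k) * w = scal c 1 -> False.
Proof.
move=> Bw c0 E; apply: (@generator_neq1 k).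
case: E => E; have := @mul_eq1 _ _ B prec basisB ordB B1.
  by move=> /(_ w 1 (a (l k)) c Bw B1 (B_gen k) c0); rewrite mulr1 => /(_ E) [].
by move=> /(_ 1 w (a (l k)) c B1 Bw (B_gen k) c0); rewrite mul1r => /(_ E) [].
Qed.

(** Absorbing a_{l_k} into the adjacent cofactor gives a multiple of a basis element other than 1,
    by [mul_generator_neq_scalar]; the second ordering axiom would then place a_{l_i} below
    itself. *)
Lemma generator_not_proper_factor i k c x y : B x -> B y -> c != 0 ->
  a (l i) <> scal c (x * (a (l k) * a (l i)) * y) /\
  a (l i) <> scal c (x * (a (l i) * a (l k)) * y).
Proof.
have [_ _ mo2] := ordB; have [irr _ _ _] := woB.
have key v s d : B v -> B s -> d != 0 -> v <> 1 \/ s <> 1 ->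
    a (l i) <> scal d (v * a (l i) * s).
  move=> Bv Bs d0 vs E; apply: (irr _ (B_gen i)).
  apply: (mo2 _ _ v s) => //; rewrite -[v * _ * s](scalK _ d0) -E.
  by rewrite LM_scal // invr_neq0.
move=> Bx By c0; split=> E.
  case: (mulB Bx (B_gen k)) => [z|[d [v [d0 Bv vE]]]].
    by apply: (basis_neq0 basisB (B_gen i)); rewrite E mulrA z !mul0r scal0r.
  apply: (key v y (c * d)) => //; first by rewrite mulf_neq0.
    left=> v1; apply: (@mul_generator_neq_scalar k d x) => //; left.
    by rewrite vE v1.
  by rewrite {1}E mulrA vE -!scalAl scalA.
case: (mulB (B_gen k) By) => [z|[d [v [d0 Bv vE]]]].
  by apply: (basis_neq0 basisB (B_gen i)); rewrite E -!mulrA z !mulr0 scal0r.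
apply: (key x v (c * d)) => //; first by rewrite mulf_neq0.
  right=> v1; apply: (@mul_generator_neq_scalar k d y) => //; right.
  by rewrite vE v1.
by rewrite {1}E -!mulrA vE -!scalAr scalA.
Qed.

(* If the generator were not normal, then an element of the Groebner basis whose
   leading monomial divides it would make redundant any commutation relation
   involving it. *)
Lemma generator_normal (i j k : 'I_n) : (i < j)%N -> k = i \/ k = j -> N (a (l k)).
Proof.
move=> ij ki; apply: contrapT => /(not_normal_dvd (B_gen k))[h GBh hk].
have [Bv _] := commutation_reduction ij.
have kg : monomial_divides B (a (l k)) (LM B prec (g j i)).
  rewrite LM_g //; case: ki => ->.
    by exists 1, (a (l j)), 1; rewrite scal1 mulr1 oner_eq0.
  by exists 1, 1, (a (l i)); rewrite scal1 mul1r oner_eq0.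
(* Otherwise a_{l_j} a_{l_i}, which has a_{l_k} as a proper factor, would divide a_{l_k}; so [h]
   survives the removal of g_ji. *)
have hg : h <> g j i.
  move=> hE; move: hk; rewrite hE LM_g // => -[c [x [y [c0 Bx By E]]]].
  case: ki => kE; rewrite kE in E.
    by case: (generator_not_proper_factor i j Bx By c0).
  by case: (generator_not_proper_factor j i Bx By c0).
apply: (@GB_min ((Omega `|` G) `\ g j i)).
  split; first by move=> f [].
  by move=> sub; have [|_] := sub (g j i); [right; exists i, j | apply].
case: GBI => GI G0 GB; split=> [f [/GI]//|f [/G0]//|f If f0].
have [f' GBf' ff'] := GB f If f0.
case: (pselect (f' = g j i)) => [fE|nf]; last by exists f'.
exists h => //; case: ff' => c [x [y [c0 Bx By E]]].
have hg' : monomial_divides B (LM B prec h) (LM B prec f').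
  rewrite fE; apply: (monomial_divides_trans basisB mulB _ hk kg).
  by rewrite LM_g.
have BLf := LM_in_basis basisB woB f0.
by apply: (monomial_divides_trans basisB mulB BLf hg'); exists c, x, y.
Qed.

End NormalMonomials.

Theorem theorem2p4 (K : fieldType) (R : algType K) (n : nat) (a : 'I_n -> R)
    (B : set R) (prec : R -> R -> Prop) (l : 'S_n)
    (Omega G : set R) (lambda : 'I_n -> 'I_n -> K)
    (g := fun j i : 'I_n =>
       a (l j) * a (l i) - lambda j i *: (a (l i) * a (l j)))
    (I := generated_ideal (Omega `|` G))
    (A := quot_alg I)
    (abar := fun i : 'I_n => quot_class I (a i))
    (N := normal_monomials B prec I)
    (Nbar := [set quot_class I u | u in N])
    (R_generated : generated_by a)
    (R_admissible : two_sided_admissible_system a B prec)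
    (B_ordered : forall alpha, B (ordered_monomial a l alpha))
    (Omega_monomials : Omega `<=` B)
    (G_def : G = [set h | exists i j : 'I_n, (i < j)%N /\ h = g j i])
    (G_card : (G #= `I_((n * (n - 1)) %/ 2)%N)%card)
    (LM_g : forall i j : 'I_n, (i < j)%N ->
       LM B prec (g j i) = a (l j) * a (l i))
    (GB_minimal : minimal_groebner_basis B prec I (Omega `|` G)) :
  (N `<=` range (ordered_monomial a l) /\
   skew_multiplicative_basis (A := A) abar Nbar) /\
  (injective (ordered_monomial a l) ->
   (forall alpha, ordered_monomial (A := A) abar l alpha <> 0 ->
      N (ordered_monomial a l alpha)) ->
   forall lt : {ffun 'I_n -> nat} -> {ffun 'I_n -> nat} -> Prop,
     [\/ lt = @lex_lt n, lt = @grlex_lt n | lt = @grevlex_lt n] ->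
     two_sided_admissible_system (A := A) abar Nbar
       (induced_ordering (A := A) abar l Nbar lt) /\
     (forall i j : 'I_n, (i < j)%N ->
        induced_ordering (A := A) abar l Nbar lt (abar (l j)) (abar (l i)))).
Proof.
have [GB GB_min] := GB_minimal.
rewrite G_def in GB GB_min.
have skew := normal_class_skew_basis R_admissible B_ordered Omega_monomials LM_g GB.
split; first by split=> //; apply: (normal_ordered R_admissible B_ordered LM_g GB).
move=> om_inj om_normal lt ltE; split.
  split=> //.
  exact: (normal_class_ordering R_admissible B_ordered Omega_monomials LM_g GB).
move=> i j ij.
(* Both generators occur in g_ji because i < j, so both are normal and their classes lie in [Nbar],
   as [induced_ordering] demands. *)
have Nk k : k = i \/ k = j -> Nbar (abar (l k)).
  move=> kij; exists (a (l k)) => //.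
  exact: (generator_normal R_admissible B_ordered LM_g GB om_inj GB_min ij kij).
split; [by apply: Nk; right | by apply: Nk; left | exists (exp_one j), (exp_one i)].
by rewrite !ordered_monomial1; split=> //; apply: exponent_ordering_exp_one.
Qed.
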